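(* Let $\kappa$ be an infinite cardinal, let $D$ be a uniform ultrafilter on $\kappa$, and let $\lambda_1,\lambda_2>\kappa$ be regular cardinals. Put $c=\langle \kappa, D,\lambda_1,\lambda_2\rangle$. Then the following are equivalent: (a) There is $\bar a\in\mathcal S_c$ which is not $c$-solvable. (b) $(\lambda_1,\lambda_2)\in\mathscr C(D)$.
   Context: Cuts and $\mathscr C(D)$. A cut of a linear order $L$ is a pair $(J^1,J^2)$ where $J^1$ is an initial segment of $L$ and $J^2=L\setminus J^1$; its cofinality is $(\theta_1,\theta_2)$, where $\theta_1$ is the cofinality of $J^1$ and $\theta_2$ is the co-initiality of $J^2$ (the cofinality of $J^2$ with reversed order). A dense linear order (without endpoints) $J$ is $\mu$-saturated if for all $A,B\subseteq J$ with $|A|,|B|<\mu$ and every element of $A$ below every element of $B$, there is $x\in J$ with $a<x<b$ for all $a\in A$, $b\in B$ ($A$ or $B$ may be empty). For an ultrafilter $D$ on $\kappa$, $\mathscr C(D)$ is the class of all pairs $(\theta_1,\theta_2)$ of infinite regular cardinals such that $(\theta_1,\theta_2)$ is the cofinality of a cut in the ultrapower $J^\kappa/D$ for some (equivalently, any) $(\theta_1+\theta_2)^+$-saturated dense linear order $J$. An ultrafilter $D$ on $\kappa$ is uniform if every member of $D$ has cardinality $\kappa$. The linear orders $N_c$, $N_c^+$. Let $c=\langle\kappa_c,D_c,\lambda_{c,1},\lambda_{c,2}\rangle$, where $D_c$ is a uniform ultrafilter on the infinite cardinal $\kappa_c$ and $\lambda_{c,1},\lambda_{c,2}>\kappa_c$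 are regular cardinals. Let $\lambda_c=2^{<\lambda_{c,1}}+2^{<\lambda_{c,2}}$ and $\lambda_{c,0}=\min\{\lambda_{c,1},\lambda_{c,2}\}$. Fix, in advance and once and for all, a linear order $N_c=N_{c,1}+N_{c,2}$ (ordered sum: all elements of $N_{c,1}$ lie below all elements of $N_{c,2}$) of size $\le\lambda_c$ such that $N_{c,1}$ has cofinality $\lambda_{c,1}$, $N_{c,2}$ has co-initiality $\lambda_{c,2}$, and both $N_{c,1}$ and $N_{c,2}$ are $\lambda_{c,0}$-saturated dense linear orders in the sense that they are $\lambda_{c,0}$-saturated models of the theory of dense linear orders. Let $N_c^+=N_{c,1}+\{s_*\}+N_{c,2}$, where $s_*$ is a new element. The conditions. For a linear order $N$ and a sequence $\bar a=\langle a_{s,t}:s,t\in N\rangle$ consider: (c-1) each $a_{s,t}$ is a subset of $\kappa_c$; (c-2) $a_{s,s}=\emptyset$; (c-3) for $s\ne t$, $a_{s,t}=\kappa_c\setminus a_{t,s}$; (c-4) $s<_N t$ implies $a_{s,t}\in D_c$; (c-5) if $s_1<_N s_2<_N s_3$, then $a_{s_1,s_3}\supseteq a_{s_1,s_2}\cap a_{s_2,s_3}$ and $a_{s_3,s_1}\supseteq a_{s_3,s_2}\cap a_{s_2,s_1}$. $\mathcal S_c$ is the set of all sequences $\bar a=\langle a_{s,t}:s,t\in N_c\rangle$ satisfying (c-1)–(c-5) with $N=N_c$. $c$-solvability. $\bar a\in\mathcal S_c$ is $c$-solvable if there is a sequence $\bar b=\langle b_s:s\in N_c\rangle$ (called a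 $c$-solution for $\bar a$) such that the sequence $\bar a^1=\langle a^1_{s,t}:s,t\in N_c^+\rangle$ defined as follows satisfies (c-1)–(c-5) with $N=N_c^+$: $a^1_{s,t}=a_{s,t}$ for $s,t\in N_c$; for $s\in N_{c,1}$, $a^1_{s,s_*}=b_s$ and $a^1_{s_*,s}=\kappa_c\setminus b_s$; for $s\in N_{c,2}$, $a^1_{s_*,s}=b_s$ and $a^1_{s,s_*}=\kappa_c\setminus b_s$; and $a^1_{s_*,s_*}=\emptyset$. *)

(* Defs.v *)
From HB Require Import structures.
From mathcomp Require Import all_boot all_order.
From mathcomp Require Import boolp classical_sets functions cardinality filter wochoice.

Set Implicit Arguments.
Unset Strict Implicit.
Unset Printing Implicit Defensive.

Import Order.TTheory.

Local Open Scope order_scope.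
Local Open Scope card_scope.
Local Open Scope classical_set_scope.

(* A cardinal is represented by any type of that cardinality.  All cardinals
   live in one universe, so that the quantifications over cardinals below
   ("the least cardinal such that ...") have the intended range. *)
Definition cardinal := Type.

Definition card_lt (T U : Type) (A : set T) (B : set U) : Prop :=
  A #<= B /\ ~ (B #<= A).

Definition card_min (L M : cardinal) : cardinal :=
  if [set: L] #<= [set: M] then L else M.

Definition is_card_succ (L M : cardinal) : Prop :=
  card_lt [set: L] [set: M] /\
  forall Q : cardinal, card_lt [set: L] [set: Q] -> [set: M] #<= [set: Q].

(* |P| = 2^{<|L|}, the supremum of the 2^mu for mu < |L|; every cardinal
   mu < |L| is the cardinality of a subset of L. *)
Definition bounds_powers_below (L P : cardinal) : Prop :=
  forall X : set L, card_lt X [set: L] -> [set Y | Y `<=` X] #<= [set: P].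

Definition is_pow2_below (L P : cardinal) : Prop :=
  bounds_powers_below L P /\
  forall Q : cardinal, bounds_powers_below L Q -> [set: P] #<= [set: Q].

Definition cofinal_in (T : Type) (r : rel T) (J X : set T) : Prop :=
  X `<=` J /\ forall x, J x -> exists2 y, X y & r x y.

(* For r the order [<=%O] this is the cofinality of J, for r the reversed
   order [>=%O] it is the co-initiality of J. *)
Definition has_cofinality (T : Type) (r : rel T) (J : set T)
    (theta : cardinal) : Prop :=
  (exists X, cofinal_in r J X /\ X #= [set: theta]) /\
  forall X, cofinal_in r J X -> [set: theta] #<= X.

(* The (reflexive) relation r makes L an initial ordinal. *)
Definition initial_ordinal (L : cardinal) (r : rel L) : Prop :=
  well_order r /\
  forall x, card_lt [set y | r y x /\ y <> x] [set: L].

Definition regular_cardinal (L : cardinal) : Prop :=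
  infinite_set [set: L] /\
  exists r : rel L, initial_ordinal r /\ has_cofinality r [set: L] L.

Definition uniform_filter (K : cardinal) (D : set_system K) : Prop :=
  forall A, D A -> A #= [set: K].

Definition is_dlo d (J : orderType d) : Prop :=
  [/\ exists x : J, True,
      forall x y : J, x < y -> exists z, x < z /\ z < y,
      forall x : J, exists y, y < x
    & forall x : J, exists y, x < y].

Definition saturated (mu : cardinal) d (J : orderType d) : Prop :=
  forall A B : set J,
    card_lt A [set: mu] -> card_lt B [set: mu] ->
    (forall a b, A a -> B b -> a < b) ->
    exists x, (forall a, A a -> a < x) /\ (forall b, B b -> x < b).

Definition saturated_dlo (mu : cardinal) d (J : orderType d) : Prop :=
  is_dlo J /\ saturated mu J.

Section Ultrapower.
Context (K : Type) (D : set_system K) (UD : UltraFilter D).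
Context d (J : orderType d).

Definition upeq (f g : K -> J) : bool := `[< \forall i \near D, f i = g i >].

Lemma upeq_is_equiv : equiv_class_of upeq.
Proof.
split=> [f|f g|g f h].
- by apply/asboolP; apply: nearW.
- by apply/asboolP/asboolP; apply: filterS.
- by move=> /asboolP fg /asboolP gh; apply/asboolP;
    apply: filterS2 fg gh => i -> ->.
Qed.

Canonical upeq_equiv := EquivRelPack upeq_is_equiv.
Canonical upeq_encModRel := defaultEncModRel upeq.

Definition ultrapower := {eq_quot upeq}%qT.
HB.instance Definition _ := Choice.on ultrapower.
HB.instance Definition _ := EqQuotient.on ultrapower.

Definition uple (x y : ultrapower) : bool :=
  `[< \forall i \near D, repr x i <= repr y i >].

Lemma uple_refl : reflexive uple.
Proof. by move=> x; apply/asboolP; apply: nearW. Qed.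

Lemma uple_anti : antisymmetric uple.
Proof.
move=> x y /andP[/asboolP xy /asboolP yx].
rewrite -[x]reprK -[y]reprK; apply/eqmodP/asboolP.
by apply: filterS2 xy yx => i xy yx; apply/le_anti/andP.
Qed.

Lemma uple_trans : transitive uple.
Proof.
move=> y x z /asboolP xy /asboolP yz; apply/asboolP.
by apply: filterS2 xy yz => i; apply: le_trans.
Qed.

Lemma uple_total : total uple.
Proof.
move=> x y.
have [xy|nxy] := in_ultra_setVsetC [set i | repr x i <= repr y i] UD.
  by apply/orP; left; apply/asboolP.
apply/orP; right; apply/asboolP; apply: filterS nxy => i /=.
by move=> /negP; rewrite -ltNge => /ltW.
Qed.

HB.instance Definition _ :=
  Order.Le_isPOrder.Build d ultrapower uple_refl uple_anti uple_trans.
HB.instance Definition _ :=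
  Order.POrder_isTotal.Build d ultrapower uple_total.

Lemma ultrapower_leE (f g : K -> J) :
  (\pi_ultrapower f <= \pi_ultrapower g)%qT <->
  \forall i \near D, (f i <= g i)%O.
Proof.
have pif (h : K -> J) : \forall i \near D, repr (\pi_ultrapower h)%qT i = h i.
  by apply/asboolP/(@eqmodP _ upeq_equiv); rewrite reprK.
split=> [/asboolP fg|fg].
  by apply: filterS3 (pif f) (pif g) fg => i -> ->.
by apply/asboolP; apply: filterS3 (pif f) (pif g) fg => i -> ->.
Qed.

End Ultrapower.

Arguments ultrapower {K D} UD {d} J.

Definition initial_segment d (T : orderType d) (J : set T) : Prop :=
  forall x y, J y -> x <= y -> J x.

(* (|L1|, |L2|) belongs to the class C(D) of the ultrafilter D. *)
Definition cut_class (K : cardinal) (D : set_system K) (UD : UltraFilter D)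
    (L1 L2 : cardinal) : Prop :=
  [/\ regular_cardinal L1, regular_cardinal L2
    & exists (mu : cardinal) d (J : orderType d),
      [/\ is_card_succ (L1 + L2)%type mu, saturated_dlo mu J
        & exists J1 : set (ultrapower UD J),
          [/\ initial_segment J1, has_cofinality <=%O J1 L1
            & has_cofinality >=%O (~` J1) L2]]].

Section OrderedSum.
Context d1 d2 (T1 : orderType d1) (T2 : orderType d2).

Definition osum : Type := (T1 + T2)%type.
HB.instance Definition _ := Choice.on osum.

Definition osum_le (x y : osum) : bool :=
  match x, y with
  | inl x1, inl y1 => x1 <= y1
  | inl _, inr _ => true
  | inr _, inl _ => false
  | inr x2, inr y2 => x2 <= y2
  end.

Lemma osum_le_refl : reflexive osum_le.
Proof. by case=> x /=. Qed.

Lemma osum_le_anti : antisymmetric osum_le.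
Proof. by case=> x [] y //= /le_anti ->. Qed.

Lemma osum_le_trans : transitive osum_le.
Proof. by case=> y [] x [] z //=; apply: le_trans. Qed.

Lemma osum_le_total : total osum_le.
Proof. by case=> x [] y //=; apply: le_total. Qed.

Fact osum_display : Order.disp_t. Proof. exact: Order.Disp tt tt. Qed.
HB.instance Definition _ := Order.Le_isPOrder.Build osum_display osum
  osum_le_refl osum_le_anti osum_le_trans.
HB.instance Definition _ :=
  Order.POrder_isTotal.Build osum_display osum osum_le_total.

End OrderedSum.

Arguments osum {d1 d2} T1 T2.

(* The requirements on N_{c,1}, N_{c,2} for c = <kappa, D, |L1|, |L2|>; here
   |P1| + |P2| is lambda_c and card_min L1 L2 is lambda_{c,0}. *)
Definition admissible (L1 L2 : cardinal) d1 d2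
    (N1 : orderType d1) (N2 : orderType d2) : Prop :=
  [/\ exists P1 P2 : cardinal, [/\ is_pow2_below L1 P1, is_pow2_below L2 P2
        & [set: osum N1 N2] #<= [set: (P1 + P2)%type]],
      has_cofinality <=%O [set: N1] L1,
      has_cofinality >=%O [set: N2] L2,
      saturated_dlo (card_min L1 L2) N1
    & saturated_dlo (card_min L1 L2) N2].

Definition coherent (K : cardinal) (D : set_system K) d (N : orderType d)
    (a : N -> N -> set K) : Prop :=
  [/\ forall s, a s s = set0,
      forall s t, s <> t -> a s t = ~` a t s,
      forall s t, s < t -> D (a s t)
    & forall s1 s2 s3, s1 < s2 -> s2 < s3 ->
        a s1 s2 `&` a s2 s3 `<=` a s1 s3 /\
        a s3 s2 `&` a s2 s1 `<=` a s3 s1].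

(* N_c^+ = N_{c,1} + {s_*} + N_{c,2}, the middle summand being the one-point
   order. *)
Definition osum_plus d1 d2 (N1 : orderType d1) (N2 : orderType d2) :=
  osum N1 (osum 'I_1 N2).

Definition extend (K : cardinal) d1 d2 (N1 : orderType d1) (N2 : orderType d2)
    (a : osum N1 N2 -> osum N1 N2 -> set K) (b : osum N1 N2 -> set K)
    (s t : osum_plus N1 N2) : set K :=
  match s, t with
  | inl s, inl t => a (inl s) (inl t)
  | inl s, inr (inr t) => a (inl s) (inr t)
  | inr (inr s), inl t => a (inr s) (inl t)
  | inr (inr s), inr (inr t) => a (inr s) (inr t)
  | inl s, inr (inl _) => b (inl s)
  | inr (inl _), inl s => ~` b (inl s)
  | inr (inl _), inr (inr s) => b (inr s)
  | inr (inr s), inr (inl _) => ~` b (inr s)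
  | inr (inl _), inr (inl _) => set0
  end.

Definition solvable (K : cardinal) (D : set_system K) d1 d2
    (N1 : orderType d1) (N2 : orderType d2)
    (a : osum N1 N2 -> osum N1 N2 -> set K) : Prop :=
  exists b : osum N1 N2 -> set K, coherent D (extend a b).

(* Main.v *)
Require Import Defs.
From HB Require Import structures.
From mathcomp Require Import all_boot all_order.
From mathcomp Require Import boolp classical_sets functions cardinality filter.
From mathcomp Require Import wochoice.

Set Implicit Arguments.
Unset Strict Implicit.
Unset Printing Implicit Defensive.

Import Order.TTheory.

Local Open Scope order_scope.
Local Open Scope classical_set_scope.
Local Open Scope card_scope.

(** A coherent system is a family, indexed by the points [i] of [K], of linear
    orders [s <_i t := a s t i] on one fixed set [N = N1 + N2]: the condition
    on triples in [coherent] excludes exactly the 3-cycles of the tournament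
    [<_i], and a tournament without 3-cycles is transitive ([coherentP]).  The
    condition that [a s t] belongs to [D] for [s < t] says that the diagonal map from [N] to the ultraproduct of the orders [(N, <_i)] is
    increasing.  A solution inserts one new point in each of these orders,
    that is, it selects a cut of each [(N, <_i)], in such a way that the new
    diagonal point lies above [N1] and below [N2] ([solvableP]).

    From an unsolvable system to a cut ([unsolvable_cut]).  Take a dense order
    [J] which is saturated enough and in which all the orders [(N, <_i)] embed.
    The embeddings map [N] increasingly into the ultrapower of [J].  Any point
    of the ultrapower lying between the images of [N1] and [N2] would cut every
    [(N, <_i)] and give a solution.  So there is none, the initial segment
    generated by the image of [N1] has a complement generated by the image of
    [N2], and the cofinalities of this cut are those of [N1] and [N2].

    From a cut to an unsolvable system ([cut_unsolvable]).  The two sides of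
    the cut have the cofinalities of [N1] and [N2], so there are monotone maps
    with cofinal range from [N1] and [N2] to them ([monotone_cofinal_map]).
    Together these give [h] from [N] to the ultrapower, and [s <_i t] is defined
    as the lexicographic order on the pairs [(h s i, s)].  The map [h] factors
    through [L1 + L2], so the range of [h ^~ i] is small, and in every
    coordinate saturation turns a cut of [(N, <_i)] into a point of [J].  A
    solution would therefore give a point of the ultrapower above all of one
    side of the cut and below all of the other, hence an extremal point of one
    of the two sides, which their infinite cofinalities forbid.

    The order [J] ([saturated_universal_dlo]) is Hausdorff's: words over a
    three-letter alphabet in which the middle letter stands from some position
    on, indexed by a well-order [W] in which
    small families are bounded, and ordered lexicographically.  Such a [W] is the
    Hartogs well-order of a type [X] with [X * option X] no larger than [X]; the
    choice [X = nat -> Y] gives this property without cardinal arithmetic. *)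

(** * Well-orders and cardinals *)

Definition wf_order d (W : orderType d) : Prop :=
  forall P : set W, P !=set0 -> exists2 m, P m & forall x, P x -> m <= x.

(** The parameter [r_wo] lets a type carry the order given by each of its
    well-orderings [r]. *)
Definition wo_type (T : Type) (r : rel T) (r_wo : well_order r) : Type := T.

Section WellOrderType.
Context (T : Type) (r : rel T) (r_wo : well_order r).
Local Notation wo_type := (wo_type r_wo).

HB.instance Definition _ := gen_eqMixin wo_type.
HB.instance Definition _ := gen_choiceMixin wo_type.

Let wo_min (P : set T) : P !=set0 -> exists2 m, P m & forall x, P x -> r m x.
Proof.
case=> x Px; have [|m [[/asboolP Pm mP] _]] := r_wo (A := fun y => `[<P y>]).
  by exists x; apply/asboolP.
by exists m => // y Py; apply: mP; apply/asboolP.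
Qed.

Lemma wo_total : total (r : rel wo_type).
Proof.
move=> x y; have [|m [->|->] mP] := @wo_min [set x; y]; first by exists x; left.
  by rewrite mP //; right.
by rewrite (mP x) ?orbT //; left.
Qed.

Lemma wo_refl : reflexive (r : rel wo_type).
Proof. by move=> x; have /orP[] := wo_total x x. Qed.

Lemma wo_anti : antisymmetric (r : rel wo_type).
Proof.
move=> x y /andP[xy yx].
have [|z [_ zU]] := r_wo (A := fun z => `[<z = x \/ z = y>]).
  by exists x; apply/asboolP; left.
have mx : minimum_of r (fun z => `[<z = x \/ z = y>]) x.
  split; first by apply/asboolP; left.
  by move=> _ /asboolP[->|->] //; apply: wo_refl.
have my : minimum_of r (fun z => `[<z = x \/ z = y>]) y.
  split; first by apply/asboolP; right.
  by move=> _ /asboolP[->|->] //; apply: wo_refl.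
by rewrite -(zU _ mx) -(zU _ my).
Qed.

Lemma wo_trans : transitive (r : rel wo_type).
Proof.
move=> y x z xy yz; have [|m Pm mP] := @wo_min [set t | t = x \/ t = y \/ t = z].
  by exists x; left.
case: Pm mP => [->|[->|->]] mP.
- by apply: mP; right; right.
- by rewrite (@wo_anti x y) // xy mP //; left.
- by rewrite (@wo_anti z y) // yz mP //; right; left.
Qed.

HB.instance Definition _ :=
  Order.Le_isPOrder.Build (Order.Disp tt tt) wo_type wo_refl wo_anti wo_trans.
HB.instance Definition _ :=
  Order.POrder_isTotal.Build (Order.Disp tt tt) wo_type wo_total.

Lemma wo_type_wf : wf_order wo_type.
Proof. exact: wo_min. Qed.

End WellOrderType.
Arguments wo_type_wf {T r} r_wo.

Lemma well_orderable (T : Type) : exists r : rel T, well_order r.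
Proof.
elim/Pchoice: T => T.
by have [r rwo] := @well_ordering_principle T; exists r.
Qed.

(** The locality hypothesis, in place of a functional [F] taking only the
    values below [v], allows [F] to be written with total functions. *)
Lemma wf_recursion d (W : orderType d) (V : Type) (F : W -> (W -> V) -> V) :
    wf_order W -> inhabited V ->
    (forall v f g, (forall u, u < v -> f u = g u) -> F v f = F v g) ->
  exists f, forall v, f v = F v f.
Proof.
move=> Wwf [v0] Floc.
have accW : well_founded (fun u v : W => u < v).
  move=> w; apply: contrapT => nw.
  have [|m nm mP] := Wwf [set v | ~ Acc (fun u v : W => u < v) v].
    by exists w.
  apply: nm; constructor=> u um; apply: contrapT => /mP.
  by rewrite leNgt um.
pose G v (rec : forall u, u < v -> V) : V :=
  F v (fun u => if pselect (u < v) is left uv then rec u uv else v0).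
exists (Fix accW (fun=> V) G) => v.
rewrite Fix_eq /G => [|u f g fg].
  by apply: Floc => u uv; case: pselect.
by apply: Floc => t tu; case: pselect.
Qed.

Lemma card_le_in (T U : Type) (A : set T) (B : set U) (f : T -> U) :
  (forall x, A x -> B (f x)) ->
  (forall x y, A x -> A y -> f x = f y -> x = y) -> A #<= B.
Proof.
move=> fAB finj; have /card_eqPle[_ le] : f @` A #= A.
  by apply: inj_card_eq => x y /set_mem + /set_mem; apply: finj.
apply: card_le_trans le _; apply: subset_card_le => _ [x Ax <-].
exact: fAB.
Qed.

(** Choose, by recursion along [W], a point of [Q] not chosen before.  If this
    never gets stuck it embeds [W] in [Q]; if it is stuck at [w], the points
    chosen below [w] exhaust [Q].  This one dichotomy is the source of all the
    comparisons of cardinals below. *)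
Lemma card_le_or_segment d (W : orderType d) (Q : Type) : wf_order W ->
  [set: W] #<= [set: Q] \/ exists w : W, [set: Q] #<= [set v | v < w].
Proof.
move=> Wwf; have [[w0]|W0] := pselect (inhabited W); last first.
  left; apply: (@card_le_in _ _ _ _ (fun w => False_rect _ (W0 (inhabits w)))).
    by [].
  by move=> w; case: W0.
have [[q0]|Q0] := pselect (inhabited Q); last first.
  by right; exists w0; apply: (@card_le_in _ _ _ _ (fun=> w0)) => x; case: Q0.
pose fresh v (f : W -> Q) q := forall u, u < v -> f u <> q.
have /choice[pick pickP] : forall P : set Q, exists q, P !=set0 -> P q.
  move=> P; have [[q Pq]|P0] := pselect (P !=set0); first by exists q.
  by exists q0.
have [||f fE] := wf_recursion (F := fun v f => pick (fresh v f)) Wwf.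
- by exists.
- move=> v f g fg; congr pick; apply/predeqP => q.
  by split=> fr u uv; [rewrite -fg|rewrite fg] => //; apply: fr.
have [fresh_ne|] := pselect (forall v, fresh v f !=set0); last first.
  move=> /existsNP[w noq]; right; exists w.
  have fsurj : [set: Q] `<=` f @` [set v | v < w].
    move=> q _; apply: contrapT => nq; apply: noq; exists q => u uw fu.
    by apply: nq; exists u.
  exact: card_le_trans (subset_card_le fsurj) (card_image_le _ _).
have f_lt u v : u < v -> f u <> f v.
  by move=> uv; rewrite (fE v); apply: (pickP _ (fresh_ne v)).
left; apply: (@card_le_in _ _ _ _ f) => // u v _ _ fuv.
by case: (ltgtP u v) => // [/f_lt|/f_lt /nesym]; rewrite fuv.
Qed.

Lemma card_le_total (T U : Type) : [set: T] #<= [set: U] \/ [set: U] #<= [set: T].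
Proof.
have [r rwo] := well_orderable T.
have [TU|[w Uw]] := card_le_or_segment U (wo_type_wf rwo); first by left.
by right; apply: card_le_trans Uw _; apply: card_leT.
Qed.

(** [W] consists of the elements of a well-ordering of the power set of [X] below
    which there are at most [|X|] elements.  Either these are all elements, and
    Cantor's theorem applies, or they form the segment below the least element
    which is not one of them. *)
Lemma hartogs (X : Type) : exists d (W : orderType d),
  [/\ wf_order W, forall w : W, [set v | v < w] #<= [set: X]
    & ~ ([set: W] #<= [set: X])].
Proof.
have [r0 r0wo] := well_orderable (set X); pose Z : orderType _ := wo_type r0wo.
have Zwf : wf_order Z := wo_type_wf r0wo.
pose S := [set z : Z | [set y | y < z] #<= [set: X]].
have cantor : ~ ([set: Z] #<= [set: X]).
  move=> /(@pcard_surjP (set X))[g gsurj].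
  have [x _ gx] := gsurj [set x | ~ g x x] I.
  have : g x x <-> ~ g x x by rewrite {1}gx.
  by case=> h1 h2; apply: (h1 _ _); apply: h2 => /[dup]/h1.
have rwo : well_order (fun u v : S => val u <= val v).
  apply: antisymmetric_well_order => [u v /le_anti/val_inj //|A [x Ax]].
  have [|_ [z Az <-] zP] := Zwf (val @` [set z | z \in A]).
    by exists (val x), x.
  by exists z; split=> // y Ay; apply: zP; exists y.
exists _, (wo_type rwo); split; first exact: wo_type_wf.
  move=> w; apply: card_le_trans (set_mem (valP w)).
  apply: (@card_le_in _ _ _ _ (val : wo_type rwo -> Z)) => [v vw|u v _ _].
    by rewrite /= ltNge; move: vw; rewrite /= ltNge.
  exact: val_inj.
have /card_eqPle[_ S_le] := card_setT S.
have [Sall|/existsNP[z Sz]] := pselect (forall z, S z).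
  move=> /(card_le_trans S_le) h; apply: cantor; apply: card_le_trans h.
  by apply: subset_card_le => z _; apply: Sall.
have [|m Sm mP] := Zwf (~` S); first by exists z.
move=> /(card_le_trans S_le) h; apply: Sm; apply: card_le_trans h.
by apply: subset_card_le => y ym; apply: contrapT => /mP; rewrite leNgt ym.
Qed.

Lemma card_succ_exists (X : Type) : exists mu : cardinal, is_card_succ X mu.
Proof.
have [d [W [Wwf segX WX]]] := hartogs X; exists W; split=> [|Q [XQ QX]].
  split=> //; have [//|[w Xw]] := card_le_or_segment X Wwf.
  exact: card_le_trans Xw (card_leT _).
have [//|[w Qw]] := card_le_or_segment Q Wwf.
by case: QX; apply: card_le_trans Qw (segX w).
Qed.

Lemma card_lt_succ (X mu : cardinal) (T : Type) (A : set T) :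
  is_card_succ X mu -> card_lt A [set: mu] -> A #<= [set: X].
Proof.
move=> [_ muP] [_ muA]; have /card_eqPle[A2 A1] := card_setT A.
have [/(card_le_trans A1) //|XA] := card_le_total A X.
apply: contrapT => AX; apply: muA; apply: card_le_trans A2.
by apply: muP; split=> // /(card_le_trans A1).
Qed.
(** * A saturated universal linear order *)

(** The regularity of the Hartogs order of [X], with strict bounds.  If
    [k @` A] were unbounded, each [w] would lie at or below some [k (a w)];
    then [w] is determined by [a w], that is by a point of [X], together with
    its rank in the segment below [k (a w)], another point of [X], or [None] if
    [w = k (a w)].  So [W] would not exceed [X * option X]. *)
Lemma short_family_bounded (X : pointedType) d (W : orderType d) (T : Type)
    (A : set T) (k : T -> W) :
    [set: X * option X] #<= [set: X] ->
    (forall w : W, [set v | v < w] #<= [set: X]) ->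
    ~ ([set: W] #<= [set: X]) ->
    A #<= [set: X] ->
  exists w, forall a, A a -> k a < w.
Proof.
move=> XX segX WX /pcard_injP[i i_inj]; apply: contrapT => unbounded.
have /choice[a aP] : forall w, exists x, A x /\ w <= k x.
  move=> w; apply: contrapT => nw; apply: unbounded; exists w => x Ax.
  by rewrite ltNge; apply/negP => wx; apply: nw; exists x.
have /choice[g g_inj] : forall w, exists g : W -> X,
    {in [set v | v < w] &, injective g}.
  by move=> w; apply/pcard_injP.
apply: WX; apply: card_le_trans XX.
pose code w := if w < k (a w) then Some (g (k (a w)) w) else None.
apply: (@card_le_in _ _ _ _ (fun w => (i (a w), code w))) => // u v _ _.
have [[Au ua] [Av va]] := (aP u, aP v).
move=> [/(i_inj _ _ (mem_set Au) (mem_set Av)) auv].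
rewrite /code -auv; rewrite -auv in va.
move: ua va; rewrite !le_eqVlt => /predU1P[uE|ua] /predU1P[vE|va].
- by rewrite uE -vE.
- by rewrite va -uE ltxx.
- by rewrite ua -vE ltxx.
rewrite ua va => -[e].
exact: (g_inj (k (a u)) u v (mem_set ua) (mem_set va) e).
Qed.

Definition agree d (W : orderType d) (V : Type) (v : W) (f g : W -> V) : Prop :=
  forall u, u < v -> f u = g u.

Lemma first_difference d (W : orderType d) (V : Type) (f g : W -> V) (w : W) :
  wf_order W -> f w <> g w -> exists v, [/\ v <= w, agree v f g & f v <> g v].
Proof.
move=> Wwf fg; have [|v fgv vP] := Wwf [set v | f v <> g v]; first by exists w.
exists v; split=> //; first exact: vP.
by move=> u uv; apply: contrapT => /vP; rewrite leNgt uv.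
Qed.


(** The neutral letter, the eventual value of all words: both the smaller letter
    [ord0] and the larger letter [ord_max] remain available at a position where
    it stands. *)
Definition mid : 'I_3 := inord 1.
Definition bounded_word d (W : orderType d) (f : W -> 'I_3) : bool :=
  `[< exists w, forall v, w <= v -> f v = mid >].

(** [Wwf] is a parameter because the order put on these words is total only when
    two distinct words have a first difference. *)
Definition lex d (W : orderType d) (Wwf : wf_order W) : Type :=
  {f : W -> 'I_3 | bounded_word f}.

Section LexicographicOrder.
Context d (W : orderType d) (Wwf : wf_order W).
Local Notation lex := (lex Wwf).

HB.instance Definition _ := SubType.on lex.
HB.instance Definition _ := [Choice of lex by <:].

Definition lex_lt (x y : lex) : Prop :=
  exists2 v, agree v (val x) (val y) & (val x v < val y v)%N.

Definition lex_le (x y : lex) : bool := `[< x = y \/ lex_lt x y >].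

Lemma lex_lt_trans x y z : lex_lt x y -> lex_lt y z -> lex_lt x z.
Proof.
move=> [u xy xyu] [v yz yzv]; have [uv|vu|uv] := ltgtP u v.
- exists u => [t tu|]; first by rewrite xy // yz // (lt_trans tu uv).
  by rewrite -yz.
- exists v => [t tv|]; first by rewrite xy ?yz // (lt_trans tv vu).
  by rewrite xy.
- rewrite -{v}uv in yz yzv; exists u => [t tu|]; first by rewrite xy // yz.
  exact: ltn_trans yzv.
Qed.

Lemma lex_lt_irr x : ~ lex_lt x x.
Proof. by case=> v _; rewrite ltnn. Qed.

Lemma lex_le_refl : reflexive lex_le.
Proof. by move=> x; apply/asboolP; left. Qed.

Lemma lex_le_anti : antisymmetric lex_le.
Proof.
move=> x y /andP[/asboolP[-> //|xy] /asboolP[-> //|yx]].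
by case: (lex_lt_irr (lex_lt_trans xy yx)).
Qed.

Lemma lex_le_trans : transitive lex_le.
Proof.
move=> y x z /asboolP[-> //|xy] /asboolP[<-|yz]; apply/asboolP; right=> //.
exact: lex_lt_trans yz.
Qed.

Lemma lex_le_total : total lex_le.
Proof.
move=> x y; have [xy|/existsNP[w xyw]] := pselect (forall w, val x w = val y w).
  by apply/orP; left; apply/asboolP; left; apply/val_inj/funext.
have [v [_ xy /eqP]] := first_difference Wwf xyw.
rewrite -val_eqE neq_ltn => /orP[lt|lt]; apply/orP; [left|right];
  apply/asboolP; right; exists v => // u uv.
by rewrite xy.
Qed.

HB.instance Definition _ := Order.Le_isPOrder.Build (Order.Disp tt tt) lex
  lex_le_refl lex_le_anti lex_le_trans.
HB.instance Definition _ :=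
  Order.POrder_isTotal.Build (Order.Disp tt tt) lex lex_le_total.

Lemma lex_ltP (x y : lex) : x < y <-> lex_lt x y.
Proof.
rewrite lt_neqAle; split=> [/andP[/eqP xy /asboolP[] //]|xy].
apply/andP; split; last by apply/asboolP; right.
by apply/eqP => e; rewrite e in xy; case: (lex_lt_irr xy).
Qed.

(** The supremum [s] of [A] among all words is defined letter by letter: [s v] is
    the largest letter found at [v] in a word of [A] that agrees with [s] below
    [v].  All words of [A] and [B] are neutral from [w0] on, so it suffices to
    cut [s] at [w0] and to decide the letter at [w0]: the small letter if [s],
    cut at [w0], belongs to [B], the large letter otherwise.  The position
    [w1] bounds the new word. *)
Lemma lex_interpolation (A B : set lex) (w0 w1 : W) :
    (forall a v, (A `|` B) a -> w0 <= v -> val a v = mid) -> w0 < w1 ->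
    (forall a b, A a -> B b -> a < b) ->
  exists x, (forall a, A a -> a < x) /\ (forall b, B b -> x < b).
Proof.
move=> bdd w01 AB.
pose reached v (f : W -> 'I_3) (c : 'I_3) :=
  exists a, [/\ A a, agree v (val a) f & val a v = c].
have maxP (P : pred 'I_3) : P ord0 -> let m := [arg max_(c > ord0 | P c) val c]%N in
    P m /\ forall c, P c -> (c <= m)%N.
  by move=> P0; case: arg_maxnP.
pose F v f := [arg max_(c > ord0 | (c == ord0) || `[<reached v f c>]) val c]%N.
have [||s sE] := wf_recursion (F := F) Wwf.
- by exists; exact: ord0.
- move=> v f g fg; rewrite /F; suff -> : reached v f = reached v g by [].
  apply/predeqP => c; split=> -[a [Aa af ac]]; exists a; split=> // u uv.
    by rewrite -fg // af.
  by rewrite fg // af.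
have sP v : (s v = ord0 \/ reached v s (s v)) /\
    forall c, reached v s c -> (c <= s v)%N.
  rewrite (sE v); have [|P1 P2] := maxP (fun c => (c == ord0) || `[<reached v s c>]).
    by rewrite eqxx.
  split=> [|c rc]; first by move: P1 => /orP[/eqP|/asboolP]; [left|right].
  by apply: P2; apply/orP; right; apply/asboolP.
have s_ge a v : A a -> agree v (val a) s -> (val a v <= s v)%N.
  by move=> Aa av; apply: (sP v).2; exists a.
have s_le b v : B b -> agree v (val b) s -> (s v <= val b v)%N.
  move=> Bb bv; case: (sP v).1 => [-> //|].
  rewrite leqNgt; case=> a [Aa av avE]; apply/negP => lt.
  have := AB _ _ Aa Bb; rewrite ltNge => /negP; apply.
  apply/ltW/lex_ltP; exists v => [u uv|]; first by rewrite av ?bv.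
  by rewrite avE.
pose top := exists2 b, B b & agree w0 (val b) s.
pose x v : 'I_3 := if v < w0 then s v
  else if v == w0 then if `[<top>] then ord0 else ord_max else mid.
have xs v : v < w0 -> x v = s v by rewrite /x => ->.
have xw0 : x w0 = if `[<top>] then ord0 else ord_max by rewrite /x ltxx eqxx.
have bx : bounded_word x.
  apply/asboolP; exists w1 => v w1v; have w0v := lt_le_trans w01 w1v.
  by rewrite /x ltNge (ltW w0v) /= gt_eqF.
exists (Sub x bx : lex); split=> [a Aa|b Bb]; apply/lex_ltP; rewrite /lex_lt SubK.
- have [aw0|/existsNP[w]] := pselect (agree w0 (val a) s).
    exists w0 => [u u0|]; first by rewrite xs ?aw0.
    rewrite xw0; case: asboolP => [[b Bb bw0]|_]; last first.
      by rewrite bdd // ?inordK //; left.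
    (* [a] and [b] agree with [s] below [w0] and are neutral afterwards *)
    have := AB _ _ Aa Bb; suff -> : a = b by rewrite ltxx.
    apply/val_inj/funext => v; have [v0|v0] := ltP v w0; first by rewrite aw0 ?bw0.
    by rewrite !bdd //; [right|left].
  move=> /not_implyP[ww0 aw]; have [v [vw av avs]] := first_difference Wwf aw.
  have v0 := le_lt_trans vw ww0.
  exists v => [u uv|]; first by rewrite xs ?av // (lt_trans uv v0).
  by rewrite xs // ltn_neqAle s_ge // andbT; apply/eqP => /val_inj.
- have [bw0|/existsNP[w]] := pselect (agree w0 (val b) s).
    exists w0 => [u u0|]; first by rewrite xs ?bw0.
    rewrite xw0; case: asboolP => [_|]; last by case; exists b.
    by rewrite bdd // ?inordK //; right.
  move=> /not_implyP[ww0 bw]; have [v [vw bv bvs]] := first_difference Wwf bw.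
  have v0 := le_lt_trans vw ww0.
  exists v => [u uv|]; first by rewrite xs ?bv // (lt_trans uv v0).
  by rewrite xs // ltn_neqAle s_le // andbT; apply/eqP => /val_inj /esym.
Qed.

End LexicographicOrder.

Definition strict_linear (T : Type) (lt : T -> T -> Prop) : Prop :=
  [/\ forall s, ~ lt s s, forall s t u, lt s t -> lt t u -> lt s u
    & forall s t, s <> t -> lt s t \/ lt t s].

(** Index the points of [U] by positions below [w] and send [s] to the
    characteristic word of the initial segment [{t | t <= s}], written with the
    letters [mid] and [ord_max].  Words of larger points are pointwise larger,
    so the well-order of the positions need not be related to [lt]. *)
Lemma lex_embeds d (W : orderType d) (Wwf : wf_order W) (w : W) (U : Type)
    (lt : U -> U -> Prop) :
    [set: U] #<= [set v | v < w] -> strict_linear lt ->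
  exists e : U -> lex Wwf, forall s t, lt s t -> e s < e t.
Proof.
move=> /card_leP[i] [irr tr tot].
pose i0 (u : U) : W := val (i (to_setT u)).
have i0w u : i0 u < w by apply: (set_mem (valP (i (to_setT u)))).
have i0_inj u v : i0 u = i0 v -> u = v.
  move=> /val_inj /(@inj _ _ _ i) h.
  by have /(congr1 val) := h (mem_set I) (mem_set I).
pose below (s : U) v := exists2 t, i0 t = v & (t = s \/ lt t s).
pose e0 s v : 'I_3 := if `[<below s v>] then ord_max else mid.
have e0b s : bounded_word (e0 s).
  apply/asboolP; exists w => v wv; rewrite /e0; case: asboolP => // -[t it _].
  by move: wv; rewrite -it leNgt i0w.
exists (fun s => Sub (e0 s) (e0b s)) => s t st; apply/lex_ltP.
rewrite /lex_lt !SubK.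
have nst : ~ below s (i0 t).
  move=> [u /i0_inj -> [ts|ts]]; last exact: irr (tr _ _ _ st ts).
  by rewrite ts in st; case: (irr s).
have bt : below t (i0 t) by exists t => //; left.
have [|v [_ ag ne]] := @first_difference _ _ _ (e0 s) (e0 t) (i0 t) Wwf.
  rewrite /e0 (asboolF nst) (asboolT bt) => /(congr1 val).
  by rewrite /= inordK.
have mono : below s v -> below t v.
  move=> [u iu us]; exists u => //; right.
  by case: us => [->|us] //; apply: tr st.
exists v => //; move: ne; rewrite /e0.
have [bs|nbs] := asboolP (below s v); have [btv|nbt] := asboolP (below t v) => // _.
  by case: nbt; apply: mono.
by rewrite /= inordK.
Qed.

(** The letter at [0] records the constructor of the option; the remaining
    letters interleave the two sequences. *)
Lemma card_pair_option (Y : Type) (y0 y1 : Y) : y0 <> y1 ->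
  [set: (nat -> Y) * option (nat -> Y)] #<= [set: nat -> Y].
Proof.
move=> y01.
pose code (p : (nat -> Y) * option (nat -> Y)) n := match n, p.2 with
  | 0%N, None => y0
  | 0%N, Some _ => y1
  | n.+1, None => p.1 n
  | n.+1, Some g => if odd n then p.1 n./2 else g n./2
  end.
apply: (@card_le_in _ _ _ _ code) => // -[f o] [f' o'] _ _ e.
case: o o' e => [g|] [g'|] e.
- have ef : f = f'.
    apply/funext => k; have := congr1 (@^~ (k.*2.+2)) e.
    by rewrite /code /= odd_double /= uphalf_double.
  suff -> : g = g' by rewrite ef.
  apply/funext => k; have := congr1 (@^~ (k.*2.+1)) e.
  by rewrite /code /= odd_double /= doubleK.
- by case: y01; have := congr1 (@^~ 0%N) e.
- by case: y01; have := congr1 (@^~ 0%N) e.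
- suff -> : f = f' by [].
  by apply/funext => k; have := congr1 (@^~ k.+1) e.
Qed.

Theorem saturated_universal_dlo (T : Type) : exists d (J : orderType d),
  [/\ is_dlo J,
      forall A B : set J, A #<= [set: T] -> B #<= [set: T] ->
        (forall a b, A a -> B b -> a < b) ->
        exists x, (forall a, A a -> a < x) /\ (forall b, B b -> x < b)
    & forall (U : Type) (lt : U -> U -> Prop),
        [set: U] #<= [set: T] -> strict_linear lt ->
        exists e : U -> J, forall s t, lt s t -> e s < e t].
Proof.
pose X := nat -> set (option T).
have TX : [set: T] #<= [set: X].
  apply: (@card_le_in _ _ _ _ (fun t _ => [set Some t])) => // s t _ _.
  move=> /(congr1 (@^~ 0%N)) /= st.
  have : [set Some s] (Some t) by rewrite st.
  by case.
have XX : [set: X * option X] #<= [set: X].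
  apply: (@card_pair_option _ set0 setT) => e.
  have : @set0 (option T) None by rewrite e.
  by [].
have [d [W [Wwf segX WX]]] := hartogs X.
have bounded U (A : set U) (k : U -> W) : A #<= [set: X] ->
    exists w, forall a, A a -> k a < w.
  exact: short_family_bounded.
have X1 U (u : U) : [set u] #<= [set: X].
  apply: (@card_le_in _ _ _ _ (fun=> point : X)) => //.
  by move=> x y -> ->.
exists _, (lex Wwf).
have bw (x : lex Wwf) : exists w, forall v, w <= v -> val x v = mid.
  exact/asboolP/(valP x).
have /choice[bd bdP] := bw.
have sat (A B : set (lex Wwf)) : A #<= [set: X] -> B #<= [set: X] ->
    (forall a b, A a -> B b -> a < b) ->
    exists x, (forall a, A a -> a < x) /\ (forall b, B b -> x < b).
  move=> /(bounded _ _ bd)[wA wAP] /(bounded _ _ bd)[wB wBP] AB.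
  have [w1 /(_ _ erefl) w01] := bounded _ _ id (X1 _ (Order.max wA wB)).
  apply: (lex_interpolation _ w01 AB) => x v [Ax|Bx]; rewrite ge_max => /andP[wAv wBv].
    by apply: bdP; apply/ltW/(lt_le_trans (wAP _ Ax)).
  by apply: bdP; apply/ltW/(lt_le_trans (wBP _ Bx)).
have X0 : (set0 : set (lex Wwf)) #<= [set: X] by apply: card_ge0.
split.
- split.
  + by have [|x _] := sat _ _ X0 X0; [|exists x].
  + move=> x y xy.
    have [|z [/(_ _ erefl) xz /(_ _ erefl) zy]] := sat _ _ (X1 _ x) (X1 _ y).
      by move=> _ _ -> ->.
    by exists z.
  + move=> x; have [|y [_ /(_ _ erefl)]] := sat _ _ X0 (X1 _ x); first by [].
    by exists y.
  + move=> x; have [|y [/(_ _ erefl) + _]] := sat _ _ (X1 _ x) X0; first by [].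
    by exists y.
- by move=> A B AT BT; apply: sat; apply: card_le_trans TX.
- move=> U lt UT lin.
  have [WU|[w Uw]] := card_le_or_segment U Wwf; last exact: lex_embeds Uw lin.
  by case: WX; apply: card_le_trans TX; apply: card_le_trans UT.
Qed.

(** * Cofinalities *)

Lemma infinite_card_inhabited (L : Type) : infinite_set [set: L] -> inhabited L.
Proof.
move=> Linf; apply: contrapT => L0; apply: Linf.
suff -> : [set: L] = set0 by apply: finite_set0.
by rewrite -subset0 => l _; apply: L0.
Qed.

(** Enumerate a cofinal set as [x], indexed by [L], and let [rank t] be the first
    index whose value is above [t].  Ranks are unbounded, because fewer than
    [|L|] points of the enumeration precede a given index, too few to be
    cofinal. *)
Lemma cofinal_ranking (L : cardinal) (r : rel L) (T : Type) (le : rel T)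
    (J : set T) (r_init : initial_ordinal r) :
    inhabited L -> has_cofinality le J L ->
  exists (x : wo_type r_init.1 -> T) (rank : T -> wo_type r_init.1),
    [/\ forall l, J (x l),
        forall t, J t -> le t (x (rank t)),
        forall t l, J t -> le t (x l) -> rank t <= l
      & forall l, exists2 t, J t & l <= rank t].
Proof.
move=> [l0] [[X [[XJ Xcof] /card_esym/card_bijP[f [g fK gK]]]] minX].
have r_wf := wo_type_wf r_init.1; set W := wo_type _ in r_wf *.
pose x (l : W) : T := val (f (to_setT l)).
have xJ l : J (x l) by apply/XJ/set_mem/valP.
have xX y : X y -> exists l, x l = y.
  move=> Xy; exists (val (g (SigSub (mem_set Xy)))); rewrite /x.
  have -> : to_setT (val (g (SigSub (mem_set Xy)))) = g (SigSub (mem_set Xy)).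
    exact: val_inj.
  by rewrite gK.
have /choice[rank rankP] : forall t, exists l : W,
    J t -> le t (x l) /\ forall m, le t (x m) -> l <= m.
  move=> t; have [Jt|nJt] := pselect (J t); last by exists (l0 : W).
  have [y /xX[l <-] tl] := Xcof _ Jt.
  have [|m tm mP] := r_wf [set l | le t (x l)]; first by exists l.
  by exists m.
exists x, rank; split=> // [t /rankP[]//|t l /rankP[_ +] tl|l]; first exact.
apply: contrapT => nl.
have := r_init.2 l; case=> _; apply.
have cof : cofinal_in le J (x @` [set m | m < l]).
  split=> [_ [m _ <-]//|t Jt]; exists (x (rank t)); last by have [] := rankP t Jt.
  by exists (rank t) => //=; rewrite ltNge; apply/negP => lt; apply: nl; exists t.
apply: card_le_trans (minX _ cof) (card_le_trans (card_image_le _ _) _).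
apply: subset_card_le => m /=; rewrite lt_neqAle => /andP[/eqP ml lml].
by split.
Qed.

(** Two sets of the same cofinality [L] are compared through [L]: send [s] to its
    rank in [J1], then to the next rank [l] of a point of [J2], then to the
    [l]-th point of the enumeration of [J2].  Restricted to ranks, that
    enumeration is increasing.  The factorization through [L] bounds the size of
    the range, whatever the sizes of [T1] and [T2]. *)
Lemma monotone_cofinal_map (L : cardinal) (T1 T2 : Type) (le1 : rel T1)
    (le2 : rel T2) (J1 : set T1) (J2 : set T2) :
    regular_cardinal L -> transitive le1 -> transitive le2 -> total le2 ->
    has_cofinality le1 J1 L -> has_cofinality le2 J2 L ->
  exists (rho : T1 -> L) (e : L -> T2),
    [/\ forall l, J2 (e l),
        forall s t, J1 s -> J1 t -> le1 s t -> le2 (e (rho s)) (e (rho t))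
      & forall y, J2 y -> exists2 s, J1 s & le2 y (e (rho s))].
Proof.
move=> [/infinite_card_inhabited L0 [r [r_init _]]] tr1 tr2 tot2.
move=> /(cofinal_ranking r_init L0)[x1 [rk1 [J1x1 x1ge rk1min rk1cof]]].
move=> /(cofinal_ranking r_init L0)[x2 [rk2 [J2x2 x2ge rk2min rk2cof]]].
have x2mono y z : J2 y -> J2 z -> rk2 y <= rk2 z ->
    le2 (x2 (rk2 y)) (x2 (rk2 z)).
  move=> Jy Jz; rewrite le_eqVlt => /predU1P[->|lt].
    by have /orP[] := tot2 (x2 (rk2 z)) (x2 (rk2 z)).
  have /orP[|zy] := tot2 (x2 (rk2 y)) z; first by move=> /tr2; apply; apply: x2ge.
  by have := rk2min _ _ Jz zy; rewrite leNgt lt.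
have /choice[nxt nxtP] : forall l, exists y, [/\ J2 y, l <= rk2 y
    & forall z, J2 z -> l <= rk2 z -> rk2 y <= rk2 z].
  move=> l; have [t Jt lt] := rk2cof l.
  have [|_ [y [Jy ly] <-] ymin] := wo_type_wf r_init.1
      (rk2 @` [set y | J2 y /\ l <= rk2 y]).
    by exists (rk2 t), t.
  by exists y; split=> // z Jz lz; apply: ymin; exists z.
exists rk1, (fun l => x2 (rk2 (nxt l))); split=> [l|s t Js Jt st|y Jy].
- exact: J2x2.
- have [Jn1 len1 min1] := nxtP (rk1 s); have [Jn2 len2 min2] := nxtP (rk1 t).
  apply: x2mono => //; apply: min1 => //; apply: le_trans len2.
  by apply: rk1min => //; apply: tr1 st _; apply: x1ge.
- have [s Js ys] := rk1cof (rk2 y); exists s => //.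
  have [Jn len _] := nxtP (rk1 s).
  by apply: tr2 (x2ge _ Jy) _; apply: x2mono => //; apply: le_trans len.
Qed.

Lemma has_cofinality_image (L : cardinal) (T1 T2 : Type) (le1 : rel T1)
    (le2 : rel T2) (J2 : set T2) (phi : T1 -> T2) :
    inhabited T1 -> antisymmetric le1 -> reflexive le2 -> transitive le2 ->
    (forall s t, le2 (phi s) (phi t) = le1 s t) -> (forall s, J2 (phi s)) ->
    (forall y, J2 y -> exists s, le2 y (phi s)) ->
  has_cofinality le1 [set: T1] L -> has_cofinality le2 J2 L.
Proof.
move=> [t0] anti1 refl2 tr2 phiE Jphi cofphi [[X [[_ Xcof] XL]] minX].
have phi_inj s t : phi s = phi t -> s = t.
  by move=> st; apply: anti1; rewrite -!phiE st refl2.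
split=> [|Y [YJ Ycof]].
  exists (phi @` X); split.
    split=> [_ [s _ <-]//|y Jy]; have [s ys] := cofphi _ Jy.
    have [t Xt st] := Xcof s I; exists (phi t); first by exists t.
    by apply: tr2 ys _; rewrite phiE.
  by apply: card_eq_trans XL; apply: inj_card_eq => s t _ _; apply: phi_inj.
have /choice[psi psiP] : forall y, exists s, J2 y -> le2 y (phi s).
  move=> y; have [Jy|] := pselect (J2 y); last by exists t0.
  by have [s] := cofphi _ Jy; exists s.
apply: card_le_trans (card_image_le psi Y); apply: minX; split=> // s _.
have [y Yy sy] := Ycof _ (Jphi s); exists (psi y); first by exists y.
by rewrite -phiE; apply: tr2 sy _; apply: psiP; apply: YJ.
Qed.

Lemma infinite_cofinality_no_max (L : cardinal) (T : Type) (le : rel T)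
    (J : set T) (y : T) :
  infinite_set [set: L] -> has_cofinality le J L -> J y ->
  ~ forall x, J x -> le x y.
Proof.
move=> Linf [_ minX] Jy ymax; apply: Linf.
apply: card_le_finite (minX [set y] _) (finite_set1 y).
by split=> [_ ->//|x Jx]; exists y => //; apply: ymax.
Qed.

(** * Coherent systems as families of linear orders *)

(** For distinct [s] and [t], reversing them complements [a s t], so for each
    [i] exactly one of [s <_i t] and [t <_i s] holds.  A failure of transitivity is then a
    3-cycle, and the two inclusions required of triples exclude the 3-cycles that run
    upwards and downwards in [N]. *)
Lemma coherentP (K : cardinal) (D : set_system K) d (N : orderType d)
    (a : N -> N -> set K) :
  coherent D a <->
  (forall i, strict_linear (fun s t => a s t i)) /\
  (forall s t, s < t -> D (a s t)).
Proof.
split=> [[a0 aC aD aT]|[lin aD]]; last first.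
  split=> // [s|s t st|s1 s2 s3 _ _].
  - by apply/predeqP => i; split=> // /(let: And3 irr _ _ := lin i in irr s).
  - apply/predeqP => i; have [irr tr tot] := lin i.
    split=> [ast ats|nts]; first exact: irr (tr _ _ _ ast ats).
    by case: (tot _ _ st).
  - by split=> i; have [_ tr _] := lin i; case; [exact: tr|exact: tr].
split=> // i.
have irr s : ~ a s s i by rewrite a0.
have asym s t : a s t i -> a t s i -> False.
  move=> st; have [e|/aC ->] := pselect (t = s); last by [].
  by rewrite e in st; case: (irr s).
have tot s t : s <> t -> a s t i \/ a t s i.
  move=> /aC ->; have [ts|nts] := pselect (a t s i); first by right.
  by left.
have up s t u : s < t -> t < u -> a s t i -> a t u i -> a u s i -> False.
  move=> st tu ast atu; apply: asym; have [h _] := aT _ _ _ st tu.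
  exact: h.
have down s t u : s < t -> t < u -> a u t i -> a t s i -> a s u i -> False.
  move=> st tu aut ats; apply: asym; have [_ h] := aT _ _ _ st tu.
  exact: h.
split=> // s t u ast atu.
have su : s <> u by move=> e; rewrite -e in atu; apply: asym atu.
have [//|aus] := tot _ _ su; exfalso.
have [st|ts|st] := ltgtP s t; last by rewrite st in ast; case: (irr t).
- have [tu|ut|tu] := ltgtP t u; last by rewrite tu in atu; case: (irr u).
    exact: up ast atu aus.
  have [us|us|us] := ltgtP u s; last by rewrite us in su.
    exact: up us st aus ast atu.
  exact: down us ut atu aus ast.
- have [us|us|us] := ltgtP u s; last by rewrite us in su.
    have [tu|ut|tu] := ltgtP t u; last by rewrite tu in atu; case: (irr u).
      exact: up tu us atu aus ast.
    exact: down ut ts ast atu aus.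
  exact: down ts us aus ast atu.
Qed.

Lemma osum_ltE d1 d2 (T1 : orderType d1) (T2 : orderType d2) (x y : osum T1 T2) :
  (x < y) = ~~ osum_le y x.
Proof. by rewrite ltNge. Qed.

Section Solvability.
Context (K : cardinal) (D : set_system K) (d1 d2 : Order.disp_t).
Context (N1 : orderType d1) (N2 : orderType d2).

(** [C i] is the part of [(N, <_i)] below the point to be inserted. *)
Definition fills (a : osum N1 N2 -> osum N1 N2 -> set K)
    (C : K -> set (osum N1 N2)) : Prop :=
  [/\ forall i s t, C i t -> a s t i -> C i s,
      forall s, D [set i | C i (inl s)]
    & forall s, D [set i | ~ C i (inr s)]].

Lemma solvableP {FD : Filter D} (a : osum N1 N2 -> osum N1 N2 -> set K) :
  coherent D a -> solvable D a <-> exists C, fills a C.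
Proof.
move=> /coherentP[lin aD].
pose old (s : osum N1 N2) : osum_plus N1 N2 :=
  match s with inl s => inl s | inr s => inr (inr s) end.
pose star : osum_plus N1 N2 := inr (inl ord0).
split=> [[b /coherentP[blin bD]]|[C [Cini CD1 CD2]]].
  exists (fun i s => extend a b (old s) star i); split=> [i s t|s|s].
  - have [_ tr _] := blin i; move=> Ct ast; apply: tr Ct.
    by case: s t ast => s [] t.
  - exact: (bD (old (inl s)) star).
  - have : D (extend a b star (old (inr s))) by apply: bD; rewrite osum_ltE.
    by apply: filterS => i /= h; apply.
pose b s := [set i | match s with inl _ => C i s | inr _ => ~ C i s end].
pose forget (p : osum_plus N1 N2) : option (osum N1 N2) := match p with
  | inl s => Some (inl s) | inr (inl _) => None | inr (inr s) => Some (inr s) end.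
have forget_inj p q : forget p = forget q -> p = q.
  case: p q => [s|[s|s]] [t|[t|t]] //= => [[->] //|_|[->] //].
  by rewrite (ord1 s) (ord1 t).
pose cut i p q := match p, q with
  | Some s, Some t => a s t i | Some s, None => C i s
  | None, Some t => ~ C i t | None, None => False end.
have extE p q i : extend a b p q i <-> cut i (forget p) (forget q).
  by case: p q => [s|[s|s]] [t|[t|t]] //=; split=> [/contrapT //|c]; apply.
have cut_lin i : strict_linear (cut i).
  have [irr tr tot] := lin i; split=> [[s|] //|[s|] [t|] [u|] //=|[s|] [t|] //=].
  - exact: irr.
  - exact: tr.
  - by move=> st /Cini; apply.
  - move=> Cs nCu; have [|//|us] := tot s u; first by move=> e; rewrite e in Cs.
    by case: nCu; apply: Cini us.
  - by move=> nt tu Cu; apply: nt; apply: Cini tu.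
  - by move=> ne; apply: tot => e; apply: ne; rewrite e.
  - by move=> _; have [] := pselect (C i s); [left|right].
  - by move=> _; have [] := pselect (C i t); [right|left].
exists b; apply/coherentP; split=> [i|].
  have [irr tr tot] := cut_lin i; split=> [s /extE /irr //|s t u|s t st].
    by rewrite !extE; apply: tr.
  by rewrite !extE; apply: tot => /forget_inj.
move=> [s|[s|s]] [t|[t|t]]; rewrite osum_ltE //= => st.
- by apply: aD; rewrite osum_ltE.
- exact: CD1.
- by apply: aD; rewrite osum_ltE.
- by move: st; rewrite (ord1 s) (ord1 t).
- exact: CD2.
- by apply: aD; rewrite osum_ltE.
Qed.
End Solvability.

(** * The equivalence *)

Section Directions.
Context (K : cardinal) (D : set_system K) (UD : UltraFilter D).
Context (L1 L2 : cardinal) (d1 d2 : Order.disp_t).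
Context (N1 : orderType d1) (N2 : orderType d2).
Context (L1reg : regular_cardinal L1) (L2reg : regular_cardinal L2).
Context (N1cof : has_cofinality <=%O [set: N1] L1).
Context (N2cof : has_cofinality >=%O [set: N2] L2).

Lemma ultrapower_ltE d (J : orderType d) (x y : ultrapower UD J) :
  x < y <-> \forall i \near D, repr x i < repr y i.
Proof.
rewrite ltNge; split=> [/negP nyx|xy].
  have [yx|] := in_ultra_setVsetC [set i | repr y i <= repr x i] UD.
    by case: nyx; apply/asboolP.
  by apply: filterS => i /= /negP; rewrite -ltNge.
apply/negP => /asboolP yx.
have : \forall i \near D, False.
  by apply: filterS2 xy yx => i xy; rewrite leNgt xy.
exact: filter_not_empty.
Qed.

Lemma repr_pi d (J : orderType d) (f : K -> J) :
  \forall i \near D, repr (\pi_(ultrapower UD J) f)%qT i = f i.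
Proof.
have h := ultrapower_leE UD (repr (\pi_(ultrapower UD J) f)%qT) f.
have h' := ultrapower_leE UD f (repr (\pi_(ultrapower UD J) f)%qT).
move: h h'; rewrite reprK => -[+ _] [+ _] => /(_ (lexx _)) h /(_ (lexx _)).
by apply: filterS2 h => i h1 h2; apply/le_anti; rewrite h1 h2.
Qed.

(** The size of [T] makes [J] saturated for families of size [|L1| + |L2|] and at
    the same time universal for orders of the size of [N]. *)
Lemma unsolvable_cut (a : osum N1 N2 -> osum N1 N2 -> set K) :
  inhabited N1 -> inhabited N2 ->
  coherent D a -> ~ solvable D a -> cut_class UD L1 L2.
Proof.
move=> N1i N2i acoh anot; split=> //.
have /coherentP[lin aD] := acoh.
pose T := (L1 + L2 + osum N1 N2)%type.
have [d [J [dloJ satJ embJ]]] := saturated_universal_dlo T.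
have NT : [set: osum N1 N2] #<= [set: T].
  by apply: (@card_le_in _ _ _ _ inr) => // s t _ _ [].
have LT : [set: (L1 + L2)%type] #<= [set: T].
  by apply: (@card_le_in _ _ _ _ inl) => // s t _ _ [].
have /choice[e eP] := fun i => embJ _ _ NT (lin i).
have [mu muP] := card_succ_exists (L1 + L2)%type.
exists mu, d, J; split=> //.
  split=> // A B /(card_lt_succ muP) Ale /(card_lt_succ muP) Ble.
  by apply: satJ; [apply: card_le_trans LT|apply: card_le_trans LT].
pose phi s : ultrapower UD J := (\pi_(ultrapower UD J) (fun i => e i s))%qT.
have phi_repr s : \forall i \near D, repr (phi s) i = e i s by exact: repr_pi.
have phi_lt s t : s < t -> phi s < phi t.
  move=> /aD st; apply/ultrapower_ltE.
  by apply: filterS3 (phi_repr s) (phi_repr t) st => i -> ->; apply: eP.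
have phi_le s t : (phi s <= phi t) = (s <= t).
  by apply/le_mono.
pose J1 := [set x | exists s : N1, x <= phi (inl s)].
have J1phi t : (~` J1) (phi (inr t)).
  by case=> s; rewrite phi_le.
exists J1; split.
- by move=> x y [s ys] xy; exists s; apply: le_trans ys.
- apply: (has_cofinality_image (phi := fun s => phi (inl s))) N1cof => //.
  + exact: le_anti.
  + exact: le_trans.
  + by move=> s; exists s.
- apply: (has_cofinality_image (phi := fun s => phi (inr s))) N2cof => //.
  + exact: ge_anti.
  + by move=> x; apply: lexx.
  + exact: ge_trans.
  + by move=> s t; rewrite /= phi_le.
  move=> y Jy; apply: contrapT => above; apply: anot.
  apply/(solvableP acoh); exists (fun i s => e i s < repr y i); split=> [i s t|s|s].
  + by move=> ty /eP st; apply: lt_trans ty.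
  + have /ultrapower_ltE : phi (inl s) < y.
      by rewrite ltNge; apply/negP => ys; apply: Jy; exists s.
    by apply: filterS2 (phi_repr (inl s)) => i ->.
  + have /ultrapower_ltE : y < phi (inr s).
      by rewrite ltNge; apply/negP => ys; apply: above; exists s.
    by apply: filterS2 (phi_repr (inr s)) => i ->; rewrite ltNge => /negP + /ltW.
Qed.

(** In each coordinate a cut of [(N, <_i)] splits the values [f s i] into a lower
    part and an upper part with at most one common value, since the order is
    lexicographic.  That value, or else saturation, provides [j i]. *)
Lemma cut_unsolvable : cut_class UD L1 L2 ->
  exists a : osum N1 N2 -> osum N1 N2 -> set K, coherent D a /\ ~ solvable D a.
Proof.
move=> [_ _ [mu [d [J [[muP1 muP2] [_ satJ] [J1 [J1ini J1cof J2cof]]]]]]].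
have [rho1 [e1 [J1e1 mono1 cof1]]] := monotone_cofinal_map L1reg
  (@le_trans _ N1) (@le_trans _ _) (@le_total _ _) N1cof J1cof.
have [rho2 [e2 [J2e2 mono2 cof2]]] := monotone_cofinal_map L2reg
  (@ge_trans _ N2) (@ge_trans _ _) (@ge_total _ _) N2cof J2cof.
have J12 x y : J1 x -> (~` J1) y -> x <= y.
  by move=> Jx Jy; rewrite leNgt; apply/negP => /ltW /(J1ini _ _ Jx).
pose h (s : osum N1 N2) : ultrapower UD J :=
  match s with inl s => e1 (rho1 s) | inr s => e2 (rho2 s) end.
have h_le s t : s <= t -> h s <= h t.
  case: s t => s [] t //= st; [exact: mono1|by apply: J12|exact: mono2].
pose f s := repr (h s).
pose a s t := [set i | f s i < f t i \/ f s i = f t i /\ s < t].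
have acoh : coherent D a.
  apply/coherentP; split=> [i|s t st].
    split=> [s|s t u|s t /eqP st].
    - by rewrite /a /= !ltxx => -[|[]].
    - move=> [st|[st st']] [tu|[tu tu']]; rewrite /a /=.
      + by left; apply: lt_trans tu.
      + by left; rewrite -tu.
      + by left; rewrite st.
      + by right; rewrite st tu; split=> //; apply: lt_trans tu'.
    - rewrite /a /=; have [lt|lt|e] := ltgtP (f s i) (f t i).
      + by left; left.
      + by right; left.
      by move: st; rewrite neq_lt => /orP[]; [left|right]; right.
  have /asboolP := h_le _ _ (ltW st).
  by apply: filterS => i; rewrite le_eqVlt => /predU1P[]; [right|left].
exists a; split=> // /(solvableP acoh)[C [Cini C1 C2]].
have /choice[j jP] : forall i, exists x,
    (forall s, C i s -> f s i <= x) /\ (forall s, ~ C i s -> x <= f s i).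
  move=> i.
  have fst s t : C i s -> ~ C i t -> f s i <= f t i.
    move=> Cs nCt; rewrite leNgt; apply/negP => lt; apply: nCt.
    by apply: Cini Cs _; left.
  pose A := [set x | exists2 s, C i s & f s i = x].
  pose B := [set x | exists2 s, ~ C i s & f s i = x].
  have [[_ [[s Cs <-] [t nCt ts]]]|AB0] := pselect (exists x, A x /\ B x).
    exists (f s i); split=> u Cu; last exact: fst.
    by rewrite -ts; apply: fst.
  pose g (l : L1 + L2) :=
    match l with inl l => repr (e1 l) i | inr l => repr (e2 l) i end.
  have small (X : set J) : (forall x, X x -> exists s, f s i = x) -> card_lt X [set: mu].
    move=> Xf; have Xg : X `<=` range g.
      move=> _ /Xf[[] s <-]; [by exists (inl (rho1 s))|by exists (inr (rho2 s))].
    have XL := card_le_trans (subset_card_le Xg) (card_image_le _ _).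
    split; first by apply: card_le_trans XL _; case: muP1.
    by move=> muX; case: muP1 => _; apply; apply: card_le_trans XL.
  have [| | |x [Ax Bx]] := satJ A B.
  - by apply: small => x [s _ <-]; exists s.
  - by apply: small => x [s _ <-]; exists s.
  - move=> _ _ [s Cs <-] [t nCt <-]; rewrite lt_neqAle fst // andbT.
    by apply/eqP => e; apply: AB0; exists (f s i); split; [exists s|exists t].
  by exists x; split=> s Cs; apply/ltW; [apply: Ax|apply: Bx]; exists s.
pose y : ultrapower UD J := (\pi_(ultrapower UD J) j)%qT.
have yj : \forall i \near D, repr y i = j i by exact: repr_pi.
have hy s : h (inl s) <= y.
  apply/asboolP; apply: filterS2 yj (C1 s) => i -> Cs.
  exact: (jP i).1 Cs.
have yh s : y <= h (inr s).
  apply/asboolP; apply: filterS2 yj (C2 s) => i -> Cs.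
  exact: (jP i).2 Cs.
have [J1y|J2y] := pselect (J1 y).
  apply: infinite_cofinality_no_max (L1reg.1) J1cof J1y _ => x.
  by move=> /cof1[s _ xs]; apply: le_trans xs (hy s).
apply: infinite_cofinality_no_max (L2reg.1) J2cof J2y _ => x.
by move=> /cof2[s _ xs]; apply: le_trans (yh s) xs.
Qed.

End Directions.

Theorem theorem1p1 (K : cardinal) (D : set_system K) (UD : UltraFilter D)
    (L1 L2 : cardinal) (d1 d2 : Order.disp_t)
    (N1 : orderType d1) (N2 : orderType d2)
    (Kinf : infinite_set [set: K]) (Dunif : uniform_filter D)
    (L1reg : regular_cardinal L1) (L2reg : regular_cardinal L2)
    (KL1 : card_lt [set: K] [set: L1]) (KL2 : card_lt [set: K] [set: L2])
    (N12 : admissible L1 L2 N1 N2) :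
  (exists a : osum N1 N2 -> osum N1 N2 -> set K,
     coherent D a /\ ~ solvable D a) <->
  cut_class UD L1 L2.
Proof.
have [_ N1cof N2cof [[N1i _ _ _] _] [[N2i _ _ _] _]] := N12.
have [s1 _] := N1i; have [s2 _] := N2i.
split=> [[a [acoh anot]]|]; last exact: cut_unsolvable.
exact: (unsolvable_cut UD L1reg L2reg N1cof N2cof (inhabits s1) (inhabits s2)
  acoh anot).
Qed.
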